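(* Let $\overline{E}$ be a nonempty finite family of nonempty convex polytopes in $\mathbb{R}^{n+1}$, and let $h\colon\mathbb{R}^n\to\mathbb{R}$, $$h(x)=\min_{C\in\overline{E}}\ \max_{[a,v]\in C}\,[a+\langle v,x\rangle],$$ be a piecewise affine function that is bounded below on $\mathbb{R}^n$. Then for a point $x_\ast\in\mathbb{R}^n$ to be a global minimizer of $h$ on $\mathbb{R}^n$ it is necessary and sufficient that $$x_\ast\in X=\bigcup_{C\in\overline{E}_\ast}X(C),$$ where $\overline{E}_\ast$ and $X(C)$ are as defined in the context.
   Context: Points of $\mathbb{R}^{n+1}$ are written $[a,v]$ with $a\in\mathbb{R}$, $v\in\mathbb{R}^n$; $0_n$ is the zero vector of $\mathbb{R}^n$ and $\langle\cdot,\cdot\rangle$ is the standard inner product. A convex polytope is the convex hull of a finite set of points. The notation $\max_{[a,0_n]\in C}a$ means the maximum of $a$ over all $a\in\mathbb{R}$ such that $[a,0_n]\in C$ (when $h$ is bounded below, every $C\in\overline{E}$ contains a point of the form $[a,0_n]$). Put $$a_\ast=\min_{C\in\overline{E}}\ \max_{[a,0_n]\in C}a,\qquad \overline{E}_\ast=\Big\{C\in\overline{E} : \max_{[a,0_n]\in C}a=a_\ast\Big\}.$$ Each $C\in\overline{E}_\ast$ is written as $C=\operatorname{conv}\{[a_i,v_i] : i\in I_C\}$ with $I_C$ a finite index set, and $$X(C)=\{x\in\mathbb{R}^n : a_i+\langle v_i,x\rangle\le a_\ast\ \text{ for all } i\in I_C\}.$$ *)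

(* Defs.v *)
From mathcomp Require Import all_boot all_order all_algebra.
From mathcomp Require Import boolp classical_sets functions cardinality reals.
From mathcomp Require Import convex.

Set Implicit Arguments.
Unset Strict Implicit.
Unset Printing Implicit Defensive.

Import Order.TTheory GRing.Theory Num.Theory.

Local Open Scope classical_set_scope.
Local Open Scope ring_scope.

(* The value is 0 when A has no maximum (resp. minimum). *)
Definition set_max (R : realType) (A : set R) : R := xget 0 (A `&` ubound A).
Definition set_min (R : realType) (A : set R) : R := xget 0 (A `&` lbound A).

Lemma set_maxE (R : realType) (A : set R) (m : R) :
  A m -> ubound A m -> set_max A = m.
Proof.
move=> Am ubm; apply: xget_unique => // y [Ay uby].
by apply/eqP; rewrite eq_le ubm// uby.
Qed.

Lemma set_minE (R : realType) (A : set R) (m : R) :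
  A m -> lbound A m -> set_min A = m.
Proof.
move=> Am lbm; apply: xget_unique => // y [Ay lby].
by apply/eqP; rewrite eq_le lbm// lby.
Qed.

Definition conv_hull (R : realType) (m : nat) (A : set 'rV[R]_m) :
  set 'rV[R]_m := smallest (@convex_set R 'rV[R]_m) A.

Definition polytope (R : realType) (m : nat) (C : set 'rV[R]_m) : Prop :=
  exists2 F : set 'rV[R]_m, finite_set F & C = conv_hull F.

Section Exhauster.
Context {R : realType} {n : nat}.
Implicit Types (a : R) (v x : 'rV[R]_n) (C : set 'rV[R]_n.+1)
  (E : set (set 'rV[R]_n.+1)).

Definition inner v x : R := \sum_(i < n) v 0 i * x 0 i.

(* The point [a, v] of R^(n+1). *)
Definition pt a v : 'rV[R]_n.+1 := row_mx (a%:M : 'rV[R]_1) v.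

Definition h E x : R :=
  set_min [set set_max [set y | exists a v, C (pt a v) /\ y = a + inner v x]
          | C in E].

Definition top_value C : R := set_max [set a | C (pt a 0)].

Definition a_star E : R := set_min [set top_value C | C in E].

Definition E_star E : set (set 'rV[R]_n.+1) :=
  [set C | E C /\ top_value C = a_star E].

(* X(C) for C = conv {[a i, v i] : i in I}. *)
Definition X_of E (I : finType) (a : I -> R) (v : I -> 'rV[R]_n) :
  set 'rV[R]_n := [set x | forall i, a i + inner (v i) x <= a_star E].

End Exhauster.

(* Main.v *)
Require Import Defs.
From mathcomp Require Import all_boot all_order all_algebra.
From mathcomp Require Import boolp classical_sets functions cardinality reals.
From mathcomp Require Import interval_inference convex lra ring.

(** Write f_C for the support function of a polytope C evaluated at the
vectors [1, x], that is f_C(x) = max of a + <v, x> over [a, v] in C, so that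
h is the pointwise minimum of the f_C.  The heart of the matter is linear
programming duality for one polytope ([top_value_duality]): when f_C is bounded
below, its infimum is the largest a with [a, 0] in C.  One half is immediate,
since [a, 0] contributes the value a to f_C(x) for every x.  The other half is
a theorem of the alternative ([polytope_alternative]): for every real t, either
f_C takes a value below t, or C contains some [c, 0] with t <= c.  Taking for t
the infimum of f_C excludes the first case, and the c given by the second case
is then the maximum that defines the top value of C.

The alternative is proved by Fourier-Motzkin elimination on the vertices of C
([elimination_alternative]).  The usual positive combination of two
inequalities that cancels a variable is normalised here so that its
coefficients sum to 1: it is then the point where a segment joining two points
of C crosses a coordinate hyperplane, and elimination never leaves C.

Since h is bounded below, so is each f_C; duality gives a_star as the infimum
of h.  If x_star minimizes h, then h(x_star) <= a_star, and any C achieving the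
minimum in h(x_star) satisfies top value of C <= f_C(x_star) <= a_star; hence C
is in E_star and all its points have value at most a_star at x_star.
Conversely, if x_star is in X(C), then h(x_star) <= f_C(x_star) <= a_star, and
a_star is a lower bound of h.  Only approximate attainment of the infima of the
f_C enters this argument, which is why the alternative can be stated with a
strict inequality, the form best suited to elimination. *)

Set Implicit Arguments.
Unset Strict Implicit.
Unset Printing Implicit Defensive.

Import Order.TTheory GRing.Theory Num.Theory.

Local Open Scope classical_set_scope.
Local Open Scope ring_scope.

(** * Extrema of finite sets of numbers *)

Lemma seq_max (R : realDomainType) (s : seq R) :
  s != [::] -> exists2 m, m \in s & forall y, y \in s -> y <= m.
Proof.
elim: s => // x s IH _; have [->|/IH[m ms max_m]] := eqVneq s [::].
  by exists x; rewrite ?mem_head// => y; rewrite inE => /eqP->.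
have [xm|mx] := leP x m.
  by exists m; rewrite ?inE ?ms ?orbT// => y /predU1P[->//|/max_m].
exists x; rewrite ?mem_head// => y /predU1P[->//|/max_m ym].
exact: le_trans ym (ltW mx).
Qed.

Lemma seq_min (R : realDomainType) (s : seq R) :
  s != [::] -> exists2 m, m \in s & forall y, y \in s -> m <= y.
Proof.
move=> s0; have /seq_max[m ms max_m] : map -%R s != [::] by case: s s0.
exists (- m); first by case/mapP: ms => x xs ->; rewrite opprK.
by move=> y ys; rewrite lerNl max_m// map_f.
Qed.

Lemma finite_set_max (R : realType) (A : set R) :
  finite_set A -> A !=set0 -> exists2 m, A m & ubound A m.
Proof.
move=> /finite_seqP[s ->] [x xs].
have [|m ms max_m] := @seq_max R s; first by case: s xs.
by exists m => // y /max_m.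
Qed.

Lemma finite_set_min (R : realType) (A : set R) :
  finite_set A -> A !=set0 -> exists2 m, A m & lbound A m.
Proof.
move=> /finite_seqP[s ->] [x xs].
have [|m ms min_m] := @seq_min R s; first by case: s xs.
by exists m => // y /min_m.
Qed.

Lemma set_min_image (R : realType) (T : Type) (A : set T) (f : T -> R) :
    finite_set A -> A !=set0 ->
  (exists2 i, A i & set_min (f @` A) = f i) /\
  (forall i, A i -> set_min (f @` A) <= f i).
Proof.
move=> Afin [i1 Ai1].
have [||_ [i0 Ai0 <-] min_i0] := @finite_set_min R (f @` A).
- exact: finite_image.
- by exists (f i1), i1.
have -> : set_min (f @` A) = f i0 by apply: set_minE => //; exists i0.
by split=> [|i Ai]; [exists i0|apply: min_i0; exists i].
Qed.

Lemma seq_separation (R : realFieldType) (L U : seq R) :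
    (forall l u, l \in L -> u \in U -> l < u) ->
  exists t, (forall l, l \in L -> l < t) /\ (forall u, u \in U -> t < u).
Proof.
move=> LU; have [->|L0] := eqVneq L [::]; have [->|U0] := eqVneq U [::].
- by exists 0.
- by have [m _ m_min] := seq_min U0; exists (m - 1); split=> // u /m_min; lra.
- by have [m _ m_max] := seq_max L0; exists (m + 1); split=> // l /m_max; lra.
have [M /LU LM M_max] := seq_max L0; have [m /LM Mm m_min] := seq_min U0.
exists ((M + m) / 2); split=> [l /M_max|u /m_min]; lra.
Qed.

(** * Points as affine functions *)

Section Points.
Context {R : realType} {n : nat}.
Implicit Types (p q : 'rV[R]_(1 + n)) (x : 'rV[R]_n) (C : set 'rV[R]_n.+1).

(** The affine function of x whose coefficient vector is p: for p = [a, v] this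
is a + <v, x>. *)
Definition value x p : R := lsubmx p 0 0 + inner (rsubmx p) x.

Lemma pt_submx p : pt (lsubmx p 0 0) (rsubmx p) = p.
Proof. by rewrite /pt -mx11_scalar hsubmxK. Qed.

Lemma value_pt x a v : value x (pt a v) = a + inner v x.
Proof. by rewrite /value /pt row_mxKl row_mxKr mxE eqxx. Qed.

Lemma inner0r v : inner v (0 : 'rV[R]_n) = 0.
Proof. by rewrite /inner big1// => i _; rewrite mxE mulr0. Qed.

Lemma inner0l x : inner 0 x = 0.
Proof. by rewrite /inner big1// => i _; rewrite mxE mul0r. Qed.

Lemma value_comb x (c d : R) p q :
  value x (c *: p + d *: q) = c * value x p + d * value x q.
Proof.
rewrite /value /inner !mulrDr !mulr_sumr !mxE addrACA -big_split/=.
by congr (_ + _); apply: eq_bigr => i _; rewrite !mxE; ring.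
Qed.

Lemma value_shift x (t : R) (j : 'I_n) p :
  value (x + t *: delta_mx 0 j) p = value x p + t * rsubmx p 0 j.
Proof.
rewrite /value -addrA; congr (_ + _); rewrite /inner.
under eq_bigr do rewrite !mxE mulrDr.
rewrite big_split/=; congr (_ + _).
  by apply: eq_bigr => i _; rewrite mxE.
rewrite (bigD1 j)//= !eqxx mulr1 big1 ?addr0 => [|i /negPf->]; last first.
  by rewrite !mulr0.
by rewrite mxE mulrC.
Qed.

(** Convexity spelled out with real weights, which can be computed with more
easily than elements of the unit interval type. *)
Definition segment_closed C :=
  forall p q (l : R), C p -> C q -> 0 <= l <= 1 -> C (l *: p + (1 - l) *: q).

Lemma segment_closed_convex C : convex_set C <-> segment_closed C.
Proof.
split=> [Cc p q l Cp Cq /andP[l0 l1]|Cc p q l].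
  by have := Cc p q (Itv01 l0 l1); rewrite !inE; apply.
by rewrite !inE => Cp Cq; apply: Cc => //; rewrite ge0/= le1.
Qed.

Lemma segment_closed_conv_hull (F : set 'rV[R]_n.+1) :
  segment_closed (conv_hull F).
Proof.
move=> p q l Fp Fq l01 K [Kc FK].
by apply: (segment_closed_convex K).1 => //; [apply: Fp|apply: Fq].
Qed.

(** A closed half-space is convex, so it contains the hull of any set that it
contains. *)
Lemma conv_hull_value_le (F : set 'rV[R]_n.+1) x (m : R) :
    (forall p, F p -> value x p <= m) ->
  forall p, conv_hull F p -> value x p <= m.
Proof.
move=> Fm p /(_ [set q | value x q <= m]); apply; split=> //.
apply/segment_closed_convex.
move=> {}p q l /= pm qm /andP[l0 l1]; rewrite value_comb; nra.
Qed.

Lemma conv_hull_nonempty (F : set 'rV[R]_n.+1) :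
  conv_hull F !=set0 -> F !=set0.
Proof.
move=> [p Fp]; apply/set0P; apply/eqP => F0.
have : (set0 : set 'rV[R]_n.+1) p; last by [].
apply: Fp; split; last by rewrite F0.
by apply/segment_closed_convex => q r l [].
Qed.

(** * Fourier-Motzkin elimination *)

(** The induction is on the number k of coordinates of the slopes that may be
nonzero.  Eliminating coordinate k keeps the points where it vanishes and
replaces the others by the points where the segments from a positive to a
negative one cross the hyperplane on which it vanishes; C being closed under
segments, these still lie in C.  A solution x of the reduced system is then
corrected along coordinate k: each positive point bounds the correction above,
each negative one below, and these bounds are compatible exactly because x
solves the inequality of every crossing point. *)
Lemma elimination_alternative C (t : R) (k : nat) (s : seq 'rV[R]_(1 + n)) :
    segment_closed C -> (forall p, p \in s -> C p) ->
    (forall p (j : 'I_n), p \in s -> (k <= j)%N -> rsubmx p 0 j = 0) ->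
  (exists x, forall p, p \in s -> value x p < t) \/
  (exists2 c, t <= c & C (pt c 0)).
Proof.
move=> Cc; elim: k s => [|k IH] s sC s0.
  have sE p : p \in s -> rsubmx p = 0.
    by move=> ps; apply/rowP => j; rewrite [RHS]mxE s0.
  have [/allP small|] := boolP (all (fun p => value 0 p < t) s).
    by left; exists 0.
  move=> /allPn[p ps]; rewrite -leNgt /value inner0r addr0 => tp.
  by right; exists (lsubmx p 0 0); rewrite // -(sE p ps) pt_submx; apply: sC.
have [nk|kn] := leqP n k.
  apply: IH => // p j _ kj.
  by have := leq_ltn_trans (leq_trans nk kj) (ltn_ord j); rewrite ltnn.
pose j0 := Ordinal kn; pose c p := rsubmx p 0 j0.
have cE p q (l d : R) : c (l *: p + d *: q) = l * c p + d * c q.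
  by rewrite /c !mxE.
(* The weight of p at the point of the segment from q to p where c vanishes. *)
pose w p q := - c q / (c p - c q).
pose cross p q := w p q *: p + (1 - w p q) *: q.
pose S0 := [seq p <- s | c p == 0].
pose Sp := [seq p <- s | 0 < c p]; pose Sn := [seq q <- s | c q < 0].
have wE p q : 0 < c p -> c q < 0 -> w p q * (c p - c q) = - c q.
  by move=> cp cq; rewrite /w divfK//; lra.
have w01 p q : 0 < c p -> c q < 0 -> 0 <= w p q <= 1.
  move=> cp cq; rewrite /w divr_ge0 ?ler_pdivrMr/=; lra.
have [||[x xs']|[d td Cd]] := IH (S0 ++ [seq cross p q | p <- Sp, q <- Sn]).
- move=> r; rewrite mem_cat => /orP[|/allpairsP[[p q] /= [pP qN ->]]].
    by rewrite mem_filter => /andP[_ /sC].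
  move: pP qN; rewrite !mem_filter => /andP[cp ps] /andP[cq qs].
  by apply: Cc; [exact: sC|exact: sC|exact: w01].
- move=> r j rs'; rewrite leq_eqVlt => /predU1P[kj|kj]; last first.
    move: rs'; rewrite mem_cat => /orP[|/allpairsP[[p q] /= [pP qN ->]]].
      by rewrite mem_filter => /andP[_ rs]; apply: s0.
    move: pP qN; rewrite !mem_filter => /andP[_ ps] /andP[_ qs].
    have := s0 _ _ ps kj; have := s0 _ _ qs kj; rewrite !mxE => -> ->.
    by rewrite !mulr0 addr0.
  have -> : j = j0 by apply: val_inj.
  rewrite -/(c r); move: rs'.
  rewrite mem_cat => /orP[|/allpairsP[[p q] /= [pP qN ->]]].
    by rewrite mem_filter => /andP[/eqP].
  move: pP qN; rewrite !mem_filter => /andP[cp _] /andP[cq _].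
  by rewrite cE; have := wE _ _ cp cq; lra.
(* Moving x by r along coordinate k changes the value of p by r * c p, so
   bound p is the r for which this value becomes t. *)
- left; pose bound p := (t - value x p) / c p.
  have [l u /mapP[q qN ->] /mapP[p pP ->]|r [rN rP]] :=
      @seq_separation R (map bound Sn) (map bound Sp).
    have /xs' : cross p q \in S0 ++ [seq cross p q | p <- Sp, q <- Sn].
      by rewrite mem_cat allpairs_f ?orbT.
    move: pP qN; rewrite !mem_filter => /andP[cp _] /andP[cq _].
    rewrite value_comb /bound ltr_pdivlMr// [(t - _) / _ * _]mulrAC.
    rewrite ltr_ndivrMr//.
    have cpq : 0 < c p - c q by lra.
    rewrite -(ltr_pM2r cpq).
    have -> : (w p q * value x p + (1 - w p q) * value x q) * (c p - c q) =
       w p q * (c p - c q) * (value x p - value x q) + value x q * (c p - c q).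
      by ring.
    by rewrite wE//; lra.
  exists (x + r *: delta_mx 0 j0) => p ps; rewrite value_shift -/(c p).
  have [cp|cp|cp] := ltgtP (c p) 0.
  + have /rN : bound p \in map bound Sn by rewrite map_f// mem_filter cp.
    by rewrite /bound ltr_ndivrMr//; lra.
  + have /rP : bound p \in map bound Sp by rewrite map_f// mem_filter cp.
    by rewrite /bound ltr_pdivlMr//; lra.
  rewrite cp mulr0 addr0; apply: xs'.
  by rewrite mem_cat mem_filter cp eqxx ps.
- by right; exists d.
Qed.

(** * Support functions and duality *)

Definition support C x : R :=
  set_max [set y | exists a v, C (pt a v) /\ y = a + inner v x].

(** Stated for an arbitrary finite generating set, because the points that
present a member of E_star need not be those witnessing that it is a polytope.
*)
Lemma support_conv_hull (F : set 'rV[R]_n.+1) x :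
    finite_set F -> conv_hull F !=set0 ->
  (exists2 p, F p & support (conv_hull F) x = value x p) /\
  (forall p, conv_hull F p -> value x p <= support (conv_hull F) x).
Proof.
move=> Ffin /conv_hull_nonempty[p1 Fp1].
have [||_ [p0 Fp0 <-] max_p0] := @finite_set_max R (value x @` F).
- exact: finite_image.
- by exists (value x p1), p1.
have le_p0 p : conv_hull F p -> value x p <= value x p0.
  by apply: conv_hull_value_le => q Fq; apply: max_p0; exists q.
have -> : support (conv_hull F) x = value x p0; last by split=> //; exists p0.
apply: set_maxE => [|_ [a [v [/le_p0 + ->]]]]; last by rewrite value_pt.
exists (lsubmx (p0 : 'rV_(1 + n)) 0 0), (rsubmx (p0 : 'rV_(1 + n))).
by rewrite pt_submx; split=> //; apply: sub_gen_smallest.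
Qed.

(** Elimination applied to the vertices: a strict bound at each of the finitely
many vertices is a strict bound on their maximum. *)
Lemma polytope_alternative C (t : R) : polytope C -> C !=set0 ->
  (exists x, support C x < t) \/ (exists2 c, t <= c & C (pt c 0)).
Proof.
move=> [F Ffin ->] F0; have [s Fs] := (finite_seqP F).1 Ffin.
have [|p j _|[x xs]|] :=
    @elimination_alternative _ t n s (@segment_closed_conv_hull F);
  last by right.
- by move=> p ps; apply: sub_gen_smallest; rewrite Fs.
- by rewrite leqNgt ltn_ord.
left; exists x; have [[p + ->] _] := support_conv_hull x Ffin F0.
by rewrite Fs => /xs.
Qed.

Lemma value_le_support C x p : polytope C -> C p -> value x p <= support C x.
Proof.
move=> [F Ffin ->] Fp.
by have [_] := support_conv_hull x Ffin (ex_intro _ p Fp); apply.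
Qed.

Lemma height_le_support C x c : polytope C -> C (pt c 0) -> c <= support C x.
Proof.
move=> Cpoly /(value_le_support x Cpoly).
by rewrite value_pt inner0l addr0.
Qed.

(** Linear programming duality.  Both inf f_C and the top value are identified
with the c produced by the alternative at level t = inf f_C; in particular the
maximum defining the top value exists. *)
Lemma top_value_duality C : polytope C -> C !=set0 ->
    has_lbound (range (support C)) ->
  (forall x, top_value C <= support C x) /\
  (forall t, top_value C < t -> exists x, support C x < t).
Proof.
move=> Cpoly C0 bnd; pose m := inf (range (support C)).
have range0 : range (support C) !=set0 by exists (support C 0), 0.
have m_le x : m <= support C x by apply: ge_inf => //; exists x.
have [[x]|[c mc Cc]] := polytope_alternative m Cpoly C0.
  by rewrite ltNge m_le.
have top_c : top_value C = c.
  apply: set_maxE => // b /= Cb; apply: le_trans mc.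
  by apply: lb_le_inf => // _ [x _ <-]; apply: height_le_support.
rewrite top_c; split=> [x|t ct]; first exact: height_le_support.
have [//|[d td Cd]] := polytope_alternative t Cpoly C0.
suff dc : d <= c by have := lt_le_trans ct (le_trans td dc); rewrite ltxx.
apply: le_trans mc.
by apply: lb_le_inf => // _ [x _ <-]; apply: height_le_support.
Qed.

End Points.

(** * Minimizers of the lower envelope *)

Theorem theorem4 (R : realType) (n : nat) (E : set (set 'rV[R]_n.+1))
  (E_finite : finite_set E) (E_nonempty : E !=set0)
  (E_polytopes : forall C, E C -> polytope C /\ C !=set0)
  (h_bounded_below : has_lbound (range (h E)))
  (I : set 'rV[R]_n.+1 -> finType)
  (a : forall C, I C -> R) (v : forall C, I C -> 'rV[R]_n)
  (E_star_conv : forall C, E_star E C ->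
     C = conv_hull (range (fun i : I C => pt (a C i) (v C i))))
  (x_star : 'rV[R]_n) :
  (forall x, h E x_star <= h E x) <->
  (\bigcup_(C in E_star E) X_of E (a C) (v C)) x_star.
Proof.
have hP x : (exists2 C, E C & h E x = support C x) /\
            (forall C, E C -> h E x <= support C x).
  exact: (set_min_image (support^~ x)).
have [[C0 EC0 aC0] a_le] : (exists2 C, E C & a_star E = top_value C) /\
    (forall C, E C -> a_star E <= top_value C).
  exact: set_min_image.
have duality C : E C -> (forall x, top_value C <= support C x) /\
    (forall t, top_value C < t -> exists x, support C x < t).
  move=> EC; have [Cpoly Cn0] := E_polytopes C EC.
  apply: top_value_duality => //.
  have [b hb] := h_bounded_below; exists b => _ [x _ <-].
  by apply: le_trans (hb _ _) ((hP x).2 C EC); exists x.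
have a_le_h x : a_star E <= h E x.
  have [[C EC ->] _] := hP x.
  exact: le_trans (a_le C EC) ((duality C EC).1 x).
split=> [x_min|[C [EC topC] xC] y].
- have h_le_a : h E x_star <= a_star E.
    apply/ler_addgt0Pr => e e0.
    have [|x xlt] := (duality C0 EC0).2 (a_star E + e).
      by rewrite -aC0 ltrDl.
    exact: le_trans (x_min x) (le_trans ((hP x).2 C0 EC0) (ltW xlt)).
  have [[C EC hC] _] := hP x_star.
  have EsC : E_star E C.
    split=> //; apply/eqP; rewrite eq_le a_le// andbT.
    by apply: le_trans h_le_a; rewrite hC; apply: (duality C EC).1.
  exists C => // i; apply: le_trans h_le_a; rewrite hC -value_pt.
  apply: value_le_support; first exact: (E_polytopes C EC).1.
  by rewrite [C in C (pt _ _)](E_star_conv C EsC);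
    apply: sub_gen_smallest; exists i.
- apply: le_trans (a_le_h y); apply: le_trans ((hP x_star).2 C EC) _.
  have hull := E_star_conv C (conj EC topC).
  have [||[_ [i _ <-]]] :=
      @support_conv_hull R n (range (fun i : I C => pt (a C i) (v C i))) x_star.
  + exact/finite_image/finite_finset.
  + by rewrite -hull; apply: (E_polytopes C EC).2.
  + by rewrite -hull value_pt => -> _; apply: xC.
Qed.
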